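(* Let $d_1\ge 2$ be a perfect square, let $a_0,b_0\in\mathbb C\setminus\{0\}$, fix a sign, and put $\alpha=\mp2/\sqrt{d_1}$, $c_0=\pm1/\sqrt{d_1}$ (upper signs together or lower signs together), $e_0=1$, $Q=2/\sqrt{d_1}$. Consider the system $$\dot x_1=-2x_1u_1,\qquad \dot x_2=x_2u_2,\qquad \dot u_1=-u_1u_2+\tfrac1{d_1}x_1,\qquad \dot u_2=-d_1u_1^2$$ and the ansatz $$x_1=\sum_{i\ge0}a_it^{\alpha+iQ},\quad x_2=\sum_{i\ge0}b_it^{1+iQ},\quad u_1=\sum_{i\ge0}c_it^{-1+iQ},\quad u_2=\sum_{i\ge0}e_it^{-1+iQ}.$$ Then the compatibility conditions for the associated recursion hold at the top resonance $iQ=2$ (that is, $i=\sqrt{d_1}$). Moreover, exactly one free parameter enters the expansion at this resonance, and this free parameter can be chosen so that the formal series solution lies on $H=0$.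
   Context: With $\iota=iQ$, substituting the ansatz gives for each $i\ge1$ the linear system $X(\iota)(a_i,b_i,c_i,e_i)^T=R_i$, where $$X(\iota)=\begin{pmatrix}\iota&0&2a_0&0\\0&\iota&0&-b_0\\0&0&\iota&\pm1/\sqrt{d_1}\\0&0&\pm2\sqrt{d_1}&\iota-1\end{pmatrix},\qquad R_i=\begin{pmatrix}-2\sum_{k=1}^{i-1}a_{i-k}c_k\\ \sum_{k=1}^{i-1}b_{i-k}e_k\\-\sum_{k=1}^{i-1}c_{i-k}e_k+d_1^{-1}a_{i-\sqrt{d_1}\pm1}\\-d_1\sum_{k=1}^{i-1}c_{i-k}c_k\end{pmatrix},$$ with the convention $a_k=0$ for $k<0$. Resonances are the values of $\iota$ with $\det X(\iota)=0$; the largest one is $\iota=2$. The compatibility conditions at a resonance hold if the right-hand side $R_i$, computed from the previous steps, lies in the image of $X(\iota)$. ''Exactly one free parameter enters'' means that the solution set of the linear system at that step is a one-dimensional affine space. Here $H=-x_2\,(d_1u_1^2-u_2^2+x_1+1)$, and ''lies on $H=0$'' means that $d_1u_1^2-u_2^2+x_1+1=0$ holds identically as a formal series. *)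

(* Defs.v *)
From HB Require Import structures.
From mathcomp Require Export all_boot all_order all_algebra.
From mathcomp Require Export classical_sets fsbigop reals.
From mathcomp Require Export complex.
Set Implicit Arguments.
Unset Strict Implicit.
Unset Printing Implicit Defensive.
Import Order.TTheory GRing.Theory Num.Theory.
Local Open Scope ring_scope.

(* Throughout, s is the natural number sqrt(d1), and up : bool selects the
   upper (true) or the lower (false) signs. *)

Definition pm (up : bool) : int := if up then 1 else -1.

Definition Qexp (s : nat) : rat := 2 / s%:R.

Definition alpha (s : nat) (up : bool) : rat := - (pm up)%:~R * 2 / s%:R.

Definition c_zero (C : numFieldType) (s : nat) (up : bool) : C :=
  (pm up)%:~R / s%:R.

(* w i is the column vector (a_i, b_i, c_i, e_i)^T. *)
Definition coefs (C : numFieldType) := nat -> 'cV[C]_4.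

Definition col4 (C : numFieldType) (x y z t : C) : 'cV[C]_4 :=
  \col_(k < 4) [:: x; y; z; t]`_k.

Definition ca (C : numFieldType) (w : coefs C) (i : nat) : C :=
  w i (@Ordinal 4 0 isT) 0.
Definition cb (C : numFieldType) (w : coefs C) (i : nat) : C :=
  w i (@Ordinal 4 1 isT) 0.
Definition cc (C : numFieldType) (w : coefs C) (i : nat) : C :=
  w i (@Ordinal 4 2 isT) 0.
Definition ce (C : numFieldType) (w : coefs C) (i : nat) : C :=
  w i (@Ordinal 4 3 isT) 0.

Definition zcoef (C : numFieldType) (a : nat -> C) (k : int) : C :=
  if k is Posz n then a n else 0.

Definition Xmat (C : numFieldType) (s : nat) (up : bool) (a0 b0 iota : C) :
    'M[C]_4 :=
  \matrix_(i < 4, j < 4) (nth [::]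
    [:: [:: iota; 0;    2 * a0;                   0                   ];
        [:: 0;    iota; 0;                        - b0                ];
        [:: 0;    0;    iota;                     (pm up)%:~R / s%:R  ];
        [:: 0;    0;    (pm up)%:~R * 2 * s%:R;   iota - 1            ]] i)`_j.

Definition Rvec (C : numFieldType) (d1 s : nat) (up : bool) (w : coefs C)
    (i : nat) : 'cV[C]_4 :=
  col4
    (- 2 * \sum_(1 <= k < i) ca w (i - k) * cc w k)
    (\sum_(1 <= k < i) cb w (i - k) * ce w k)
    (- (\sum_(1 <= k < i) cc w (i - k) * ce w k)
       + d1%:R^-1 * zcoef (ca w) (i%:Z - s%:Z + pm up))
    (- d1%:R * \sum_(1 <= k < i) cc w (i - k) * cc w k).

Definition iota_at (C : numFieldType) (s i : nat) : C :=
  ratr (i%:R * Qexp s).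

Definition initial_data (C : numFieldType) (s : nat) (up : bool) (a0 b0 : C)
    (w : coefs C) : Prop :=
  w 0%N = col4 a0 b0 (c_zero C s up) 1.

Definition step_solution (C : numFieldType) (d1 s : nat) (up : bool)
    (a0 b0 : C) (w : coefs C) (i : nat) (v : 'cV[C]_4) : Prop :=
  Xmat s up a0 b0 (iota_at C s i) *m v = Rvec d1 s up w i.

Definition solved_below (C : numFieldType) (d1 s : nat) (up : bool)
    (a0 b0 : C) (n : nat) (w : coefs C) : Prop :=
  initial_data s up a0 b0 w /\
  forall i, (1 <= i < n)%N -> step_solution d1 s up a0 b0 w i (w i).

Definition solved (C : numFieldType) (d1 s : nat) (up : bool)
    (a0 b0 : C) (w : coefs C) : Prop :=
  initial_data s up a0 b0 w /\
  forall i, (1 <= i)%N -> step_solution d1 s up a0 b0 w i (w i).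

Definition resonance (C : numFieldType) (s : nat) (up : bool) (a0 b0 : C)
    (iota : C) : Prop :=
  \det (Xmat s up a0 b0 iota) = 0.

(* On C = R[i], z <= iota forces z - iota to be real. *)
Definition top_resonance (C : numFieldType) (s : nat) (up : bool) (a0 b0 : C)
    (iota : C) : Prop :=
  resonance s up a0 b0 iota /\
  forall z, resonance s up a0 b0 z -> z <= iota.

Definition compatible_at (C : numFieldType) (d1 s : nat) (up : bool)
    (a0 b0 : C) (w : coefs C) (i : nat) : Prop :=
  exists v : 'cV[C]_4, step_solution d1 s up a0 b0 w i v.

Definition affine_of_dim (C : numFieldType) (n : nat)
    (S : 'cV[C]_4 -> Prop) : Prop :=
  exists (v0 : 'cV[C]_4) (U : {vspace 'cV[C]_4}),
    \dim U = n /\ forall v, S v <-> v - v0 \in U.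

(* Formal series in t with rational exponents: f q is the coefficient of t^q. *)
Definition fseries (C : numFieldType) := rat -> C.

(* The series \sum_(i >= 0) f_i t^(r + i p), for p != 0. *)
Definition ansatz (C : numFieldType) (r p : rat) (f : nat -> C) : fseries C :=
  fun q => if (q - r) / p \is a Num.nat
           then f (Num.truncn ((q - r) / p)) else 0.

Definition fone (C : numFieldType) : fseries C := fun q => (q == 0)%:R.

(* Cauchy product. For two series of the form [ansatz r p f] with the same
   p > 0 the sum has finite support; otherwise an infinite sum would be 0 by
   the convention for \sum_(_ \in _). *)
Definition fmul (C : numFieldType) (f g : fseries C) : fseries C :=
  fun q => \sum_(x \in [set: rat]) f x * g (q - x).

Definition fderiv (C : numFieldType) (f : fseries C) : fseries C :=
  fun q => ratr (q + 1) * f (q + 1).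

Definition solves_system (C : numFieldType) (d1 : nat)
    (x1 x2 u1 u2 : fseries C) : Prop :=
  forall q : rat,
  [/\ fderiv x1 q = - 2 * fmul x1 u1 q,
      fderiv x2 q = fmul x2 u2 q,
      fderiv u1 q = - fmul u1 u2 q + d1%:R^-1 * x1 q
    & fderiv u2 q = - d1%:R * fmul u1 u1 q].

Definition lies_on_H0 (C : numFieldType) (d1 : nat)
    (x1 u1 u2 : fseries C) : Prop :=
  forall q : rat,
    d1%:R * fmul u1 u1 q - fmul u2 u2 q + x1 q + fone C q = 0.

Definition x1_of (C : numFieldType) (s : nat) (up : bool) (w : coefs C) :=
  ansatz (alpha s up) (Qexp s) (ca w).
Definition x2_of (C : numFieldType) (s : nat) (w : coefs C) :=
  ansatz 1 (Qexp s) (cb w).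
Definition u1_of (C : numFieldType) (s : nat) (w : coefs C) :=
  ansatz (-1) (Qexp s) (cc w).
Definition u2_of (C : numFieldType) (s : nat) (w : coefs C) :=
  ansatz (-1) (Qexp s) (ce w).

Definition extends_at (C : numFieldType) (n : nat) (w : coefs C)
    (v : 'cV[C]_4) (w' : coefs C) : Prop :=
  (forall i, (i < n)%N -> w' i = w i) /\ w' n = v.

(* Main.v *)
Require Import Defs.
From mathcomp Require Import all_boot all_order all_algebra.
From mathcomp Require Import classical_sets fsbigop reals complex.
From mathcomp Require Import zify ring.
Set Implicit Arguments.
Unset Strict Implicit.
Unset Printing Implicit Defensive.
Import Order.TTheory GRing.Theory Num.Theory.
Local Open Scope ring_scope.

(* The determinant of X(iota) is iota^2 (iota - 2) (iota + 1), so every step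
   other than i = s = sqrt d1 is uniquely solvable. The (c, e)-block has no
   source until a_0 enters, at i = s - 1 (upper sign) or i = s + 1 (lower sign);
   hence the third and fourth entries of R_s vanish. Such a vector R_s is
   X(2) (R_s / 2), and the kernel of X(2) is a line along which c_s is a free
   coordinate.
   The series G = d1 u1^2 - u2^2 + x1 + 1 has zero derivative, so only its
   constant term matters. That term is affine in c_s with slope 6 eps s, where
   eps is the sign, and c_s can be chosen to cancel it. *)

Section CauchyProduct.
Variable R : comNzRingType.
Implicit Types (f g h : nat -> R) (m n : nat).

Definition cauchy f g n : R := \sum_(k < n.+1) f (n - k)%N * g k.

Definition cauchy_inner f g n : R := \sum_(1 <= k < n) f (n - k)%N * g k.

Definition delay m f n : R := if (n < m)%N then 0 else f (n - m)%N.

(* The operator [Q t d/dt] on the series [\sum_n f_n t^n]. *)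
Definition euler (Q : R) f n : R := n%:R * Q * f n.

Lemma cauchy0 f g : cauchy f g 0 = f 0 * g 0.
Proof. by rewrite /cauchy big_ord1. Qed.

Lemma cauchy_ends f g n : (0 < n)%N ->
  cauchy f g n = f n * g 0 + f 0 * g n + cauchy_inner f g n.
Proof.
move=> n_gt0; rewrite /cauchy -(big_mkord xpredT (fun k => f (n - k)%N * g k)).
by rewrite big_nat_recr //= big_ltn // subn0 subnn addrAC.
Qed.

Lemma eq_cauchy f f' g g' n :
  (forall k, (k <= n)%N -> f k = f' k) ->
  (forall k, (k <= n)%N -> g k = g' k) ->
  cauchy f g n = cauchy f' g' n.
Proof.
by move=> ff' gg'; apply: eq_bigr => k _; rewrite ff' ?leq_subr // gg' // -ltnS.
Qed.

Lemma eq_cauchyr f g g' n : g =1 g' -> cauchy f g n = cauchy f g' n.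
Proof. by move=> gg'; apply: eq_cauchy. Qed.

Lemma eq_cauchy_inner f f' g g' n :
  (forall k, (k < n)%N -> f k = f' k) ->
  (forall k, (k < n)%N -> g k = g' k) ->
  cauchy_inner f g n = cauchy_inner f' g' n.
Proof.
by move=> ff' gg'; apply: eq_big_nat => k kn; rewrite ff' ?gg' //; lia.
Qed.

Lemma cauchy_inner_eq0 f g n :
  (forall k, (0 < k < n)%N -> f (n - k)%N = 0 \/ g k = 0) ->
  cauchy_inner f g n = 0.
Proof.
move=> fg0; rewrite /cauchy_inner big_nat big1 // => k /fg0.
by case=> ->; rewrite ?mul0r ?mulr0.
Qed.

Lemma eq_delay m f f' n : (0 < m)%N -> (forall k, (k < n)%N -> f k = f' k) ->
  delay m f n = delay m f' n.
Proof.
by move=> m_gt0 ff'; rewrite /delay; case: ltnP => // mn; rewrite ff' //; lia.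
Qed.

Lemma cauchyC f g n : cauchy f g n = cauchy g f n.
Proof.
rewrite /cauchy (reindex_inj rev_ord_inj); apply: eq_bigr => k _ /=.
by rewrite subSS subKn 1?mulrC // -ltnS.
Qed.

Lemma cauchyDr f g h n :
  cauchy f (fun k => g k + h k) n = cauchy f g n + cauchy f h n.
Proof. by rewrite -big_split; apply: eq_bigr => k _; rewrite mulrDr. Qed.

Lemma cauchyZr (x : R) f g n :
  cauchy f (fun k => x * g k) n = x * cauchy f g n.
Proof. by rewrite mulr_sumr; apply: eq_bigr => k _; rewrite mulrCA. Qed.

Lemma coefM_cauchy (p q : {poly R}) n :
  (p * q)`_n = cauchy (nth 0 p) (nth 0 q) n.
Proof. by rewrite coefMr. Qed.

Lemma cauchyA f g h n : cauchy f (cauchy g h) n = cauchy (cauchy f g) h n.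
Proof.
pose trunc (u : nat -> R) := \poly_(k < n.+1) u k.
have truncE u k : (k <= n)%N -> (trunc u)`_k = u k.
  by rewrite coef_poly ltnS => ->.
have truncM u v k : (k <= n)%N -> (trunc u * trunc v)`_k = cauchy u v k.
  move=> kn; rewrite coefM_cauchy.
  by apply: eq_cauchy => j jk; apply: truncE; exact: leq_trans kn.
have := congr1 (nth 0 \o val) (mulrA (trunc f) (trunc g) (trunc h)).
move/(congr1 (@^~ n)); rewrite /= !coefM_cauchy.
rewrite (eq_cauchy (@truncE f) (truncM g h)).
by rewrite (eq_cauchy (truncM f g) (@truncE h)).
Qed.

Lemma cauchy_delayl m f g n :
  cauchy (delay m f) g n = delay m (cauchy f g) n.
Proof.
rewrite cauchyC {2}/delay /cauchy; case: ltnP => [nm|mn].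
  rewrite big1 // => k _; rewrite /delay ifT ?mulr0 //.
  by rewrite (leq_trans _ nm) // ltn_ord.
rewrite -(subnK mn) addnC -addnS big_split_ord /= big1 ?add0r; last first.
  by move=> k _; rewrite /delay ltn_ord mulr0.
rewrite addKn -/(cauchy f g _) cauchyC; apply: eq_bigr => k _.
by rewrite subnDl /delay ltnNge leq_addr addKn.
Qed.

Lemma euler_cauchy Q f g n :
  euler Q (cauchy f g) n = cauchy (euler Q f) g n + cauchy f (euler Q g) n.
Proof.
rewrite -big_split [LHS]mulr_sumr.
apply: eq_bigr => k _; have kn : (k <= n)%N by rewrite -ltnS.
by rewrite /euler -{1}(subnK kn) natrD /=; ring.
Qed.

Lemma euler_cauchy_sqr Q f n :
  euler Q (cauchy f f) n = 2 * cauchy f (euler Q f) n.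
Proof. by rewrite euler_cauchy cauchyC mulr_natl mulr2n. Qed.

(* With [D = euler Q] the hypotheses read [d (D c) = d c - d c e + a],
   [D e = e - d c^2] and [D a = 2 a - 2 a c]; they cancel in
   [(D - 2) (d c^2 - e^2 + a)]. *)
Lemma conserved_coef (Q d : R) (c e a : nat -> R) :
  (forall n, d * ((n%:R * Q - 1) * c n) = a n - d * cauchy c e n) ->
  (forall n, (n%:R * Q - 1) * e n = - d * cauchy c c n) ->
  (forall n, (n%:R * Q - 2) * a n = - 2 * cauchy a c n) ->
  forall n, (n%:R * Q - 2) * (d * cauchy c c n - cauchy e e n + a n) = 0.
Proof.
move=> Dc De Da n.
have cDc : d * cauchy c (euler Q c) n =
    d * cauchy c c n + (cauchy c a n + - d * cauchy c (cauchy c e) n).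
  rewrite -!cauchyZr -!cauchyDr; apply: eq_cauchyr => k.
  by rewrite mulNr -Dc /euler; ring.
have eDe : cauchy e (euler Q e) n =
    cauchy e e n + - d * cauchy e (cauchy c c) n.
  rewrite -!cauchyZr -!cauchyDr; apply: eq_cauchyr => k.
  by rewrite -De /euler; ring.
have -> : (n%:R * Q - 2) * (d * cauchy c c n - cauchy e e n + a n) =
    d * euler Q (cauchy c c) n - euler Q (cauchy e e) n + (n%:R * Q - 2) * a n
    - 2 * (d * cauchy c c n - cauchy e e n) by rewrite /euler; ring.
rewrite !euler_cauchy_sqr mulrCA cDc eDe Da.
rewrite (cauchyC a c) (cauchyC e (cauchy c c)) -cauchyA.
by ring.
Qed.

End CauchyProduct.

Section FormalSeries.
Variable C : numFieldType.
Implicit Types (f g : nat -> C) (F G : fseries C) (r p q x : rat).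

Lemma ansatz_on r p f n : p != 0 -> ansatz r p f (r + n%:R * p) = f n.
Proof. by move=> p0; rewrite /ansatz addrC addKr mulfK // natr_nat natrK. Qed.

Lemma ansatz_neq0 r p f q : p != 0 -> ansatz r p f q != 0 ->
  exists n : nat, q = r + n%:R * p.
Proof.
move=> p0; rewrite /ansatz; case: ifP; last by rewrite eqxx.
move=> /natrP[n qn] _.
by exists n; rewrite -qn mulfVK // addrC subrK.
Qed.

Lemma ansatz_unique r p f F : p != 0 ->
  (forall n, F (r + n%:R * p) = f n) ->
  (forall q, F q != 0 -> exists n : nat, q = r + n%:R * p) ->
  F =1 ansatz r p f.
Proof.
move=> p0 F_on F_supp q.
have [Fq0|/F_supp[n ->]] := eqVneq (F q) 0; last by rewrite F_on ansatz_on.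
have [->|/(ansatz_neq0 p0)[n qn]] := eqVneq (ansatz r p f q) 0 => //.
by rewrite qn F_on ansatz_on.
Qed.

Lemma eq_ansatz r p f g : f =1 g -> ansatz r p f =1 ansatz r p g.
Proof. by move=> fg q; rewrite /ansatz; case: ifP. Qed.

Lemma ansatz_eq0 r p f : (forall n, f n = 0) -> forall q, ansatz r p f q = 0.
Proof. by move=> f0 q; rewrite /ansatz; case: ifP. Qed.

Lemma ansatzD r p f g q :
  ansatz r p (fun n => f n + g n) q = ansatz r p f q + ansatz r p g q.
Proof. by rewrite /ansatz; case: ifP; rewrite ?addr0. Qed.

Lemma ansatzZ r p (a : C) f q :
  ansatz r p (fun n => a * f n) q = a * ansatz r p f q.
Proof. by rewrite /ansatz; case: ifP; rewrite ?mulr0. Qed.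

Lemma ansatzN r p f q : ansatz r p (fun n => - f n) q = - ansatz r p f q.
Proof. by rewrite /ansatz; case: ifP; rewrite ?oppr0. Qed.

Lemma ansatz_delay r p f m : p != 0 ->
  ansatz (r + m%:R * p) p f =1 ansatz r p (delay m f).
Proof.
move=> p0; apply: ansatz_unique => // [n|q /(ansatz_neq0 p0)[n ->]]; last first.
  by exists (m + n)%N; rewrite natrD mulrDl addrA.
rewrite /delay; case: ltnP => [nm|mn]; last first.
  by rewrite -{1}(subnKC mn) natrD mulrDl addrA ansatz_on.
apply: contraTeq nm => /(ansatz_neq0 p0)[k].
rewrite -addrA -mulrDl -natrD => /addrI/(mulIf p0)/eqP; rewrite eqr_nat.
by move=> /eqP ->; rewrite -leqNgt leq_addr.
Qed.

Lemma fderiv_ansatz r p f : p != 0 ->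
  fderiv (ansatz r p f) =1
  ansatz (r - 1) p (fun n => ratr (r + n%:R * p) * f n).
Proof.
move=> p0; apply: ansatz_unique => // [n|q]; rewrite /fderiv.
  by rewrite addrAC subrK ansatz_on.
rewrite mulf_eq0 negb_or => /andP[_ /(ansatz_neq0 p0)[n qn]].
by exists n; rewrite addrAC -qn addrK.
Qed.

Lemma fone_ansatz p n : p != 0 ->
  @fone C =1 ansatz (- (n%:R * p)) p (fun k => (k == n)%:R).
Proof.
move=> p0; apply: ansatz_unique => // [k|q]; rewrite /fone.
  by rewrite addrC subr_eq0 (inj_eq (mulIf p0)) eqr_nat.
have [->|_] := eqVneq q 0; last by rewrite eqxx.
by exists n; rewrite addNr.
Qed.

Lemma fmul_neq0 F G q :
  fmul F G q != 0 -> exists x, F x * G (q - x) != 0.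
Proof.
by move=> /(@fsbigN1 _ _ _ _ _ _ (fun y x => F x * G (y - x)))[x _]; exists x.
Qed.

Lemma fmul_finite (s : seq rat) F G q : uniq s ->
  (forall x, F x * G (q - x) != 0 -> x \in s) ->
  fmul F G q = \sum_(x <- s) F x * G (q - x).
Proof.
move=> s_uniq supp; rewrite /fmul (fsbigE s) //.
  by apply: eq_bigl => x; rewrite in_setT.
by move=> x _; apply: contraNeq; exact: supp.
Qed.

Lemma ansatzM_neq0 r1 r2 p f g q x : p != 0 ->
  ansatz r1 p f x * ansatz r2 p g (q - x) != 0 ->
  exists k m : nat, x = r1 + k%:R * p /\ q = r1 + r2 + (k + m)%:R * p.
Proof.
move=> p0; rewrite mulf_eq0 negb_or => /andP[].
move=> /(ansatz_neq0 p0)[k xk] /(ansatz_neq0 p0)[m qm]; exists k, m; split=> //.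
by rewrite -[q](subrK x) qm xk natrD; ring.
Qed.

Lemma fmul_ansatz r1 r2 p f g : p != 0 ->
  fmul (ansatz r1 p f) (ansatz r2 p g) =1 ansatz (r1 + r2) p (cauchy f g).
Proof.
move=> p0; apply: ansatz_unique => // [n|q]; last first.
  by move=> /fmul_neq0[x /(ansatzM_neq0 p0)[k [m [_ qkm]]]]; exists (k + m)%N.
pose expo k := r1 + k%:R * p.
have expo_inj : injective expo.
  by move=> i j /addrI/(mulIf p0)/eqP; rewrite eqr_nat => /eqP.
rewrite (@fmul_finite [seq expo k | k <- index_iota 0 n.+1]).
- rewrite big_map big_mkord cauchyC; apply: eq_bigr => k _.
  rewrite /expo ansatz_on // mulrC; congr (_ * _).
  rewrite -(ansatz_on r2 g _ p0) natrB; first by congr (ansatz _ _ _ _); ring.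
  by rewrite -ltnS.
- by rewrite map_inj_uniq ?iota_uniq.
move=> x /(ansatzM_neq0 p0)[k [m [-> /addrI/(mulIf p0)/eqP]]].
rewrite eqr_nat (mem_map expo_inj) mem_index_iota => /eqP ->.
by rewrite ltnS leq_addr.
Qed.

End FormalSeries.

Section LinearStep.
Variable C : numFieldType.
Implicit Types (a b x y z t iota : C) (u v : 'cV[C]_4).

Lemma affine_line (S : 'cV[C]_4 -> Prop) v0 u : u != 0 ->
  (forall v, S v <-> exists z, v = v0 + z *: u) -> affine_of_dim 1 S.
Proof.
move=> u_neq0 SE; exists v0, <[u]>%VS; split; first by rewrite dim_vline u_neq0.
move=> v; rewrite SE; split=> [[z ->]|/vlineP[z vz]].
  by rewrite addrC addKr; apply/vlineP; exists z.
by exists z; rewrite -vz addrC subrK.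
Qed.

Lemma col4P x y z t x' y' z' t' :
  col4 x y z t = col4 x' y' z' t' <-> [/\ x = x', y = y', z = z' & t = t'].
Proof.
split => [/matrixP e|[-> -> -> ->] //].
by split; [have := e (@Ordinal 4 0 isT) 0 | have := e (@Ordinal 4 1 isT) 0
  | have := e (@Ordinal 4 2 isT) 0 | have := e (@Ordinal 4 3 isT) 0];
  rewrite !mxE.
Qed.

Lemma col4_eta v : v = col4 (v (@Ordinal 4 0 isT) 0) (v (@Ordinal 4 1 isT) 0)
  (v (@Ordinal 4 2 isT) 0) (v (@Ordinal 4 3 isT) 0).
Proof.
apply/matrixP => i j; rewrite ord1 mxE.
by case: i => [[|[|[|[|]]]] hi] //=; congr (v _ _); apply: val_inj.
Qed.

Lemma scale_col4 a x y z t :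
  a *: col4 x y z t = col4 (a * x) (a * y) (a * z) (a * t).
Proof. by apply/matrixP => i j; rewrite !mxE; case: i => [[|[|[|[|]]]] ?]. Qed.

Section Signed.
Variables (s : nat) (up : bool).
Hypothesis s_gt0 : (0 < s)%N.

Local Notation eps := ((pm up)%:~R : C).

Let s_neq0 : s%:R != 0 :> C. Proof. by rewrite pnatr_eq0 -lt0n. Qed.

Lemma pm_sqr : eps ^+ 2 = 1.
Proof. by rewrite /pm; case: up; rewrite ?sqrrN expr1n. Qed.

Lemma mulmx_Xmat_col4 a b iota x y z t :
  Xmat s up a b iota *m col4 x y z t =
  col4 (iota * x + 2 * a * z) (iota * y - b * t)
    (iota * z + eps / s%:R * t) (eps * 2 * s%:R * z + (iota - 1) * t).
Proof.
apply/matrixP => i j; rewrite !mxE !big_ord_recl big_ord0 !mxE /=.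
by case: i => [[|[|[|[|]]]] hi] //=; ring.
Qed.

Lemma det_Xmat a b iota :
  \det (Xmat s up a b iota) = iota ^+ 2 * ((iota - 2) * (iota + 1)).
Proof.
do 3![rewrite (expand_det_col _ ord0) !big_ord_recl big_ord0 !mxE /=;
  rewrite ?mul0r !addr0 /cofactor].
rewrite !det_mx11 !mxE /= !expr0.
have := pm_sqr; move: (_%:~R) => e e_sqr.
by field: e_sqr.
Qed.

Lemma det_Xmat_eq0 a b iota :
  (\det (Xmat s up a b iota) == 0) = (iota \in [:: 0; 2; -1]).
Proof.
by rewrite det_Xmat mulf_eq0 expf_eq0 mulf_eq0 subr_eq0 addr_eq0 !inE.
Qed.

Lemma Xmat_unitmx a b iota :
  (Xmat s up a b iota \in unitmx) = (iota \notin [:: 0; 2; -1]).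
Proof. by rewrite unitmxE unitfE det_Xmat_eq0. Qed.

Lemma ce_block_injective iota z t : iota != 2 -> iota != -1 ->
  iota * z + eps / s%:R * t = 0 -> eps * 2 * s%:R * z + (iota - 1) * t = 0 ->
  z = 0 /\ t = 0.
Proof.
rewrite -subr_eq0 -[iota == -1]subr_eq0 opprK => iota2 iotaN1 row_c row_e.
have z0 : z = 0.
  apply: (mulfI (mulf_neq0 iota2 iotaN1)); rewrite mulr0.
  rewrite (_ : _ * z = (iota - 1) * (iota * z + eps / s%:R * t) -
    eps / s%:R * (eps * 2 * s%:R * z + (iota - 1) * t)).
    by rewrite row_c row_e !mulr0 subr0.
  by field: pm_sqr.
split=> //; move/eqP: row_c; rewrite z0 mulr0 add0r mulf_eq0 => /orP[|/eqP //].
by rewrite mulf_eq0 invr_eq0 (negPf s_neq0) orbF -sqrf_eq0 pm_sqr oner_eq0.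
Qed.

Definition Xmat2_ker a b : 'cV[C]_4 :=
  col4 (- a) (- (eps * s%:R * b)) 1 (- 2 * eps * s%:R).

Lemma Xmat2_ker_neq0 a b : Xmat2_ker a b != 0.
Proof.
apply/eqP => /matrixP/(_ (@Ordinal 4 2 isT) 0); rewrite !mxE /= => /eqP.
by rewrite oner_eq0.
Qed.

Lemma Xmat2_kerP a b v :
  Xmat s up a b 2 *m v = 0 <-> exists z, v = z *: Xmat2_ker a b.
Proof.
have zero_col4 : (0 : 'cV[C]_4) = col4 0 0 0 0 by rewrite [LHS]col4_eta !mxE.
have two_neq0 : 2 != 0 :> C by rewrite pnatr_eq0.
suff col4_case x y z t : Xmat s up a b 2 *m col4 x y z t = 0 <->
  exists r, col4 x y z t = r *: Xmat2_ker a b by rewrite (col4_eta v).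
rewrite mulmx_Xmat_col4 zero_col4 col4P.
split=> [[row_a row_b _ row_e]|[r]]; last first.
  rewrite scale_col4 => /col4P[-> -> -> ->].
  by split; field: pm_sqr.
exists z; rewrite scale_col4; apply/col4P.
have tE : t = z * (- 2 * eps * s%:R) by apply: subr0_eq; rewrite -row_e; ring.
split; [| |by rewrite mulr1|exact: tE]; apply: (mulfI two_neq0).
  by apply: subr0_eq; rewrite -row_a; ring.
by apply: subr0_eq; rewrite -row_b tE; ring.
Qed.

Lemma mulmx_Xmat2_half a b x y :
  Xmat s up a b 2 *m (2^-1 *: col4 x y 0 0) = col4 x y 0 0.
Proof.
by rewrite scale_col4 mulmx_Xmat_col4; apply/col4P; split; field.
Qed.

Lemma Xmat2_solutionP a b x y v :
  Xmat s up a b 2 *m v = col4 x y 0 0 <->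
  exists z, v = 2^-1 *: col4 x y 0 0 + z *: Xmat2_ker a b.
Proof.
rewrite -{1}(mulmx_Xmat2_half a b x y).
split=> [/eqP|[z ->]].
  rewrite -subr_eq0 -mulmxBr => /eqP/Xmat2_kerP[z vz]; exists z.
  by rewrite -vz addrC subrK.
rewrite mulmxDr; suff -> : Xmat s up a b 2 *m (z *: Xmat2_ker a b) = 0.
  by rewrite addr0.
by apply/Xmat2_kerP; exists z.
Qed.

End Signed.
End LinearStep.

Section CourseOfValues.
Variables (T : Type) (F : (nat -> T) -> nat -> T).
Hypothesis F_causal : forall u v n,
  (forall k, (k < n)%N -> u k = v k) -> F u n = F v n.

Lemma iter_causal u n m m' : (n < m)%N -> (n < m')%N ->
  iter m F u n = iter m' F u n.
Proof.
elim/ltn_ind: n m m' => n IH [//|m] [//|m'] nm nm' /=.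
by apply: F_causal => k kn; apply: IH => //; lia.
Qed.

Lemma course_of_values (u : nat -> T) : exists w, w =1 F w.
Proof.
exists (fun n => iter n.+1 F u n) => n /=.
by apply: F_causal => k kn; exact: (iter_causal u kn (ltnSn k)).
Qed.

End CourseOfValues.

(* The index of the step at which [a_0] enters the equation of [u_1]. *)
Definition source_index (s : nat) (up : bool) : nat :=
  if up then s.-1 else s.+1.

Lemma zcoef_source (C : numFieldType) s up (f : nat -> C) n : (0 < s)%N ->
  zcoef f (n%:Z - s%:Z + pm up) = delay (source_index s up) f n.
Proof.
move=> s_gt0; have -> : n%:Z - s%:Z + pm up = n%:Z - (source_index s up)%:Z.
  by rewrite /source_index /pm; case: up; lia.
rewrite /delay; case: ltnP => [nm|mn]; last by rewrite subzn.
by rewrite (_ : _ - _ = Negz (source_index s up - n).-1) //; lia.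
Qed.

Section Recursion.
Variables (C : numFieldType) (d1 s : nat) (up : bool) (a0 b0 : C).
Hypotheses (s_gt1 : (1 < s)%N) (d1E : d1 = (s ^ 2)%N).
Implicit Types (w : coefs C) (v : 'cV[C]_4) (i n : nat).

Local Notation eps := ((pm up)%:~R : C).
Local Notation iota i := (iota_at C s i).
Local Notation src := (source_index s up).

Let s_gt0 : (0 < s)%N. Proof. exact: ltnW. Qed.
Let s_neq0 : s%:R != 0 :> C. Proof. by rewrite pnatr_eq0 -lt0n. Qed.
Let rat_s_neq0 : s%:R != 0 :> rat. Proof. by rewrite pnatr_eq0 -lt0n. Qed.
Let d1_sqr : d1%:R = s%:R ^+ 2 :> C. Proof. by rewrite d1E natrX. Qed.
Let eps_sqr : eps ^+ 2 = 1. Proof. exact: pm_sqr. Qed.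

Lemma Qexp_neq0 : Qexp s != 0.
Proof. by rewrite /Qexp mulf_neq0 ?invr_neq0. Qed.

Lemma Qexp_top : s%:R * Qexp s = 2.
Proof. by rewrite /Qexp mulrCA divff ?mulr1. Qed.

Lemma alpha_source : alpha s up = -2 + src%:R * Qexp s.
Proof.
rewrite /alpha /Qexp /source_index /pm; case: up.
  by rewrite -subn1 natrB; [field | ].
by rewrite -addn1 natrD; field.
Qed.

Lemma iota_atE i : iota i = i%:R * (2 / s%:R).
Proof. by rewrite /iota_at /Qexp rmorphM fmorph_div /= !ratr_nat. Qed.

Lemma iota_at_top : iota s = 2.
Proof. by rewrite iota_atE mulrCA divff ?mulr1. Qed.

Lemma ratr_exponent (r : rat) n : ratr (r + n%:R * Qexp s) = ratr r + iota n.
Proof. exact: rmorphD. Qed.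

Lemma ratr_alpha : ratr (alpha s up) = - 2 * (eps / s%:R) :> C.
Proof.
rewrite /alpha !rmorphM rmorphN fmorphV /= ratr_int !ratr_nat.
by ring.
Qed.

Lemma iota_at_inj : injective (iota_at C s).
Proof.
have Q_neq0 : 2 / s%:R != 0 :> C by rewrite mulf_neq0 ?invr_neq0 // pnatr_eq0.
move=> i j; rewrite !iota_atE => /(mulIf Q_neq0)/eqP.
by rewrite eqr_nat => /eqP.
Qed.

Lemma iota_at_nonresonant i :
  (0 < i)%N -> i != s -> iota i \notin [:: 0; 2; -1].
Proof.
move=> i_gt0 i_neq_s.
rewrite !inE -iota_at_top (inj_eq iota_at_inj) (negPf i_neq_s).
have iota_gt0 : 0 < iota i by rewrite iota_atE mulr_gt0 ?divr_gt0 ?ltr0n.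
by rewrite gt_eqF //= gt_eqF // (lt_trans _ iota_gt0) // ltrN10.
Qed.

Lemma top_resonance_at : top_resonance s up a0 b0 (iota s).
Proof.
rewrite iota_at_top /top_resonance /resonance; split=> [|z].
  by apply/eqP; rewrite det_Xmat_eq0 // !inE eqxx orbT.
move/eqP; rewrite det_Xmat_eq0 // !inE => /or3P[] /eqP -> //.
by rewrite (le_trans (lerN10 _)).
Qed.

Lemma eq_Rvec w w' i : (forall k, (k < i)%N -> w k = w' k) ->
  Rvec d1 s up w i = Rvec d1 s up w' i.
Proof.
move=> ww'; have coef_eq (l : 'I_4) k : (k < i)%N -> w k l 0 = w' k l 0.
  by move=> /ww' ->.
rewrite /Rvec !zcoef_source // (eq_delay _ (@coef_eq _)); last first.
  by rewrite /source_index; case: up; lia.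
congr (col4 (_ * _) _ (- _ + _) (_ * _));
  by apply: eq_cauchy_inner => k; exact: coef_eq.
Qed.

Lemma recursion_extension n w : (0 < n)%N -> exists w',
  (forall i, (i < n)%N -> w' i = w i) /\
  forall i, (n <= i)%N -> i != s -> step_solution d1 s up a0 b0 w' i (w' i).
Proof.
move=> n_gt0.
have [|w' w'E] := @course_of_values _ (fun u i => if (i < n)%N then w i
    else invmx (Xmat s up a0 b0 (iota i)) *m Rvec d1 s up u i) _ w.
  by move=> u u' i uu'; rewrite (eq_Rvec uu').
exists w'; split=> i; rewrite w'E; first by move=> ->.
move=> n_le_i i_neq_s; rewrite ltnNge n_le_i /= /step_solution mulKVmx //.
by rewrite Xmat_unitmx // iota_at_nonresonant // (leq_trans n_gt0).
Qed.

Lemma solved_below_exists n : (n <= s)%N ->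
  exists w, solved_below d1 s up a0 b0 n w.
Proof.
move=> n_le_s.
have [w [w0 w_step]] :=
  @recursion_extension 1 (fun=> col4 a0 b0 (c_zero C s up) 1) isT.
exists w; split=> [|i /andP[i_gt0 i_lt_n]]; first exact: w0.
by apply: w_step => //; lia.
Qed.

Lemma eq_solved_below n w w' : (0 < n)%N ->
  (forall k, (k < n)%N -> w' k = w k) ->
  solved_below d1 s up a0 b0 n w -> solved_below d1 s up a0 b0 n w'.
Proof.
move=> n_gt0 w'w [w0 w_step]; split=> [|i /andP[i_gt0 i_lt_n]].
  by rewrite /initial_data w'w.
rewrite /step_solution w'w // (@eq_Rvec w' w).
  by apply: w_step; rewrite i_gt0.
by move=> k k_lt_i; rewrite w'w // (ltn_trans k_lt_i).
Qed.

Lemma step_solution_extends n w v : (0 < n)%N ->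
  solved_below d1 s up a0 b0 n w -> step_solution d1 s up a0 b0 w n v ->
  solved_below d1 s up a0 b0 n.+1 (fun i => if i == n then v else w i).
Proof.
move=> n_gt0 w_solved v_step; set w' := fun i => _.
have w'w k : (k < n)%N -> w' k = w k by rewrite /w' => /ltn_eqF ->.
have [w'0 w'_step] := eq_solved_below n_gt0 w'w w_solved.
split=> // i /andP[i_gt0]; rewrite ltnS leq_eqVlt => /orP[/eqP ->|i_lt_n].
  by rewrite /step_solution (eq_Rvec w'w) {1}/w' eqxx.
by apply: w'_step; rewrite i_gt0.
Qed.

Lemma solved_extension n w : (s < n)%N -> solved_below d1 s up a0 b0 n w ->
  exists w', (forall i, (i < n)%N -> w' i = w i) /\ solved d1 s up a0 b0 w'.
Proof.
move=> s_lt_n w_solved; have n_gt0 : (0 < n)%N by apply: leq_trans s_lt_n.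
have [w' [w'w w'_step]] := recursion_extension w n_gt0.
have [w'0 w'_below] := eq_solved_below n_gt0 w'w w_solved.
exists w'; split=> //; split=> // i i_gt0.
have [i_lt_n|n_le_i] := ltnP i n; first by apply: w'_below; rewrite i_gt0.
by apply: w'_step => //; rewrite gtn_eqF // (leq_trans s_lt_n).
Qed.

Lemma step_solution_rows w i : step_solution d1 s up a0 b0 w i (w i) ->
  [/\ iota i * ca w i + 2 * a0 * cc w i = - 2 * cauchy_inner (ca w) (cc w) i,
      iota i * cb w i - b0 * ce w i = cauchy_inner (cb w) (ce w) i,
      iota i * cc w i + eps / s%:R * ce w i =
        - cauchy_inner (cc w) (ce w) i + d1%:R^-1 * delay src (ca w) i
    & eps * 2 * s%:R * cc w i + (iota i - 1) * ce w i =
        - d1%:R * cauchy_inner (cc w) (cc w) i].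
Proof.
rewrite /step_solution {1}(col4_eta (w i)) mulmx_Xmat_col4 /Rvec.
by rewrite zcoef_source // => /col4P.
Qed.

Section BelowTop.
Variable w : coefs C.
Hypothesis w_solved : solved_below d1 s up a0 b0 s w.

Lemma cc_ce_eq0_before_source i :
  (0 < i < s)%N -> (i < src)%N -> cc w i = 0 /\ ce w i = 0.
Proof.
elim/ltn_ind: i => i IH i_range i_src.
have prev_eq0 k : (0 < k < i)%N -> cc w k = 0 /\ ce w k = 0.
  by move=> k_range; apply: IH; lia.
have [_ _] := step_solution_rows (w_solved.2 _ i_range).
rewrite !cauchy_inner_eq0 => [|k /prev_eq0[]|k /prev_eq0[]];
  [|by right|by right].
rewrite /delay i_src oppr0 !mulr0 addr0.
have : iota i \notin [:: 0; 2; -1] by apply: iota_at_nonresonant; lia.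
by rewrite !inE !negb_or => /and3P[_ ? ?]; exact: ce_block_injective.
Qed.

Lemma cc1_eq0 : cc w 1 = 0.
Proof.
have [src_gt1|] := ltnP 1 src.
  by have [] := @cc_ce_eq0_before_source 1 s_gt1 src_gt1.
rewrite /source_index => src_le1.
have [s2 up_true] : s = 2 /\ up by move: src_le1; case: up => //; lia.
have [_ _ _] := step_solution_rows (w_solved.2 1 s_gt1).
rewrite /cauchy_inner big_geq // mulr0 iota_atE s2 mul1r divff ?pnatr_eq0 //.
rewrite subrr mul0r addr0 => /eqP; rewrite mulf_eq0 => /orP[|/eqP //].
by rewrite !mulf_eq0 -[eps == 0]sqrf_eq0 eps_sqr oner_eq0 !pnatr_eq0.
Qed.

Lemma ca1_eq0 : ca w 1 = 0.
Proof.
have [+ _ _ _] := step_solution_rows (w_solved.2 1 s_gt1).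
rewrite /cauchy_inner big_geq // cc1_eq0 !mulr0 addr0 => /eqP.
rewrite mulf_eq0 iota_atE !mulf_eq0 invr_eq0 (negPf s_neq0) !pnatr_eq0.
by move/eqP.
Qed.

Lemma delay_ca_top : delay src (ca w) s = 0.
Proof.
rewrite /delay /source_index; case: up; last by rewrite ltnSn.
by rewrite ifN; [rewrite (_ : _ - _ = 1)%N ?ca1_eq0 //; lia | lia].
Qed.

(* A nonzero source enters below [s] only at [s - 1], where it is multiplied by
   [c_1 = 0]. *)
Lemma cauchy_inner_cc_top g :
  (forall k, (0 < k < s)%N -> (k < src)%N -> g k = 0) ->
  cauchy_inner (cc w) g s = 0.
Proof.
move=> g0; apply: cauchy_inner_eq0 => k k_range.
have [k_src|src_k] := ltnP k src; first by right; exact: g0.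
left; rewrite (_ : s - k = 1)%N ?cc1_eq0 //.
by move: src_k; rewrite /source_index; case: up; lia.
Qed.

Lemma cauchy_inner_cc_cc_top : cauchy_inner (cc w) (cc w) s = 0.
Proof.
apply: cauchy_inner_cc_top => k k_range k_src.
by have [] := cc_ce_eq0_before_source k_range k_src.
Qed.

Lemma cauchy_inner_cc_ce_top : cauchy_inner (cc w) (ce w) s = 0.
Proof.
apply: cauchy_inner_cc_top => k k_range k_src.
by have [] := cc_ce_eq0_before_source k_range k_src.
Qed.

Lemma Rvec_top : Rvec d1 s up w s =
  col4 (- 2 * cauchy_inner (ca w) (cc w) s) (cauchy_inner (cb w) (ce w) s) 0 0.
Proof.
rewrite /Rvec zcoef_source // delay_ca_top mulr0 addr0.
rewrite -/(cauchy_inner (cc w) (ce w) s) -/(cauchy_inner (cc w) (cc w) s).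
by rewrite cauchy_inner_cc_ce_top cauchy_inner_cc_cc_top oppr0 mulr0.
Qed.

Definition top_solution (z : C) : 'cV[C]_4 :=
  2^-1 *: Rvec d1 s up w s + z *: Xmat2_ker s up a0 b0.

Lemma top_solutionP v :
  step_solution d1 s up a0 b0 w s v <-> exists z, v = top_solution z.
Proof.
rewrite /step_solution /top_solution iota_at_top Rvec_top.
exact: Xmat2_solutionP.
Qed.

Lemma top_solution_cc z : top_solution z (@Ordinal 4 2 isT) 0 = z.
Proof. by rewrite /top_solution Rvec_top !mxE /= mulr0 add0r mulr1. Qed.

End BelowTop.

Section Solved.
Variable w : coefs C.
Hypothesis w_solved : solved d1 s up a0 b0 w.

Lemma initialE :
  [/\ ca w 0 = a0, cb w 0 = b0, cc w 0 = eps / s%:R & ce w 0 = 1].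
Proof. by rewrite /ca /cb /cc /ce w_solved.1; split; rewrite mxE. Qed.

Lemma coef_recursion n :
  [/\ ratr (alpha s up + n%:R * Qexp s) * ca w n = - 2 * cauchy (ca w) (cc w) n,
      ratr (1 + n%:R * Qexp s) * cb w n = cauchy (cb w) (ce w) n,
      ratr (-1 + n%:R * Qexp s) * cc w n =
        - cauchy (cc w) (ce w) n + d1%:R^-1 * delay src (ca w) n
    & ratr (-1 + n%:R * Qexp s) * ce w n = - d1%:R * cauchy (cc w) (cc w) n].
Proof.
have [a_0 b_0 c_0 e_0] := initialE.
rewrite !ratr_exponent ratr_alpha rmorphN rmorph1 -/(iota n).
case: n => [|n].
  rewrite !cauchy0 iota_atE a_0 b_0 c_0 e_0 /delay ifT; last first.
    by rewrite /source_index; case: up; lia.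
  by rewrite d1_sqr; split; field: eps_sqr.
have [row_a row_b row_c row_e] := step_solution_rows (w_solved.2 n.+1 isT).
rewrite !cauchy_ends // a_0 b_0 c_0 e_0; split.
- by rewrite mulrDr -row_a; ring.
- by rewrite -row_b; ring.
- by rewrite opprD -addrA -row_c; ring.
by rewrite mulrDr -row_e d1_sqr; field.
Qed.

Lemma x1_of_delay : x1_of s up w =1 ansatz (-2) (Qexp s) (delay src (ca w)).
Proof.
by move=> q; rewrite /x1_of alpha_source ansatz_delay ?Qexp_neq0.
Qed.

Lemma solved_solves_system :
  solves_system d1 (x1_of s up w) (x2_of s w) (u1_of s w) (u2_of s w).
Proof.
have Q0 := Qexp_neq0; move=> q; rewrite x1_of_delay /x1_of /x2_of /u1_of /u2_of.
rewrite !fderiv_ansatz // !fmul_ansatz //.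
rewrite -!ansatzZ -ansatzN -ansatzD.
by split; apply: eq_ansatz => n; have [] := coef_recursion n.
Qed.

(* The coefficient of [t^(-2 + n Q)] in [d1 u_1^2 - u_2^2 + x_1 + 1]. *)
Definition H0_coef n : C :=
  d1%:R * cauchy (cc w) (cc w) n - cauchy (ce w) (ce w) n + delay src (ca w) n
  + (n == s)%:R.

Lemma H0_coefP : (forall n, H0_coef n = 0) ->
  lies_on_H0 d1 (x1_of s up w) (u1_of s w) (u2_of s w).
Proof.
move=> H0_coef0 q; rewrite x1_of_delay (fone_ansatz _ s Qexp_neq0) Qexp_top.
rewrite !(fmul_ansatz _ _ _ _ Qexp_neq0) -ansatzZ -ansatzN -!ansatzD.
exact: ansatz_eq0.
Qed.

Lemma delay_ca_recursion n : (iota n - 2) * delay src (ca w) n =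
  - 2 * cauchy (delay src (ca w)) (cc w) n.
Proof.
rewrite cauchy_delayl /delay.
case: ltnP => [|src_le_n]; first by rewrite !mulr0.
have [<- _ _ _] := coef_recursion (n - src); congr (_ * _).
rewrite alpha_source -addrA -mulrDl -natrD subnKC //.
by rewrite ratr_exponent rmorphN /= ratr_nat addrC.
Qed.

Lemma H0_coef_eq0 n : n != s -> H0_coef n = 0.
Proof.
move=> n_neq_s; rewrite /H0_coef (negPf n_neq_s) addr0.
have d1_neq0 : d1%:R != 0 :> C by rewrite d1_sqr expf_neq0.
have exponentE k : iota k - 1 = ratr (-1 + k%:R * Qexp s).
  by rewrite ratr_exponent rmorphN1 addrC.
have iota_neq2 : iota n - 2 != 0.
  by rewrite subr_eq0 -iota_at_top (inj_eq iota_at_inj).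
apply: (mulfI iota_neq2); rewrite mulr0 iota_atE.
apply: conserved_coef => k; rewrite -iota_atE; last exact: delay_ca_recursion.
  have [_ _ row_c _] := coef_recursion k; rewrite exponentE row_c.
  by field.
by have [_ _ _ row_e] := coef_recursion k; rewrite exponentE.
Qed.

Lemma H0_coef_top :
  H0_coef s = 6 * eps * s%:R * cc w s + 1 - cauchy_inner (ce w) (ce w) s.
Proof.
have w_below : solved_below d1 s up a0 b0 s w.
  by split=> [|i /andP[i_gt0 _]]; [exact: w_solved.1 | exact: w_solved.2].
have inner0 := cauchy_inner_cc_cc_top w_below.
have [_ _ c_0 e_0] := initialE.
have [_ _ _] := step_solution_rows (w_solved.2 s s_gt0).
rewrite iota_at_top inner0 mulr0 => row_e.
have e_s : ce w s = - 2 * eps * s%:R * cc w s.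
  by apply: subr0_eq; rewrite -row_e; ring.
rewrite /H0_coef eqxx !cauchy_ends // inner0 delay_ca_top // c_0 e_0 e_s d1_sqr.
by rewrite mulr1n; field.
Qed.

End Solved.

Lemma extends_at_exists w v : solved_below d1 s up a0 b0 s w ->
  step_solution d1 s up a0 b0 w s v ->
  exists w', extends_at s w v w' /\ solved d1 s up a0 b0 w'.
Proof.
move=> w_solved /(step_solution_extends s_gt0 w_solved).
move=> /(solved_extension (ltnSn s))[w' [w'E w'_solved]].
exists w'; split=> //; split=> [i i_lt_s|]; last by rewrite w'E // eqxx.
by rewrite w'E ?(ltn_eqF i_lt_s) // ltnW.
Qed.

Definition H0_parameter w : C :=
  (cauchy_inner (ce w) (ce w) s - 1) / (6 * eps * s%:R).

Lemma H0_parameter_lies_on_H0 w w' : solved_below d1 s up a0 b0 s w ->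
  extends_at s w (top_solution w (H0_parameter w)) w' ->
  solved d1 s up a0 b0 w' ->
  lies_on_H0 d1 (x1_of s up w') (u1_of s w') (u2_of s w').
Proof.
move=> w_solved [w'w w's] w'_solved; apply: H0_coefP => n.
have [->|] := eqVneq n s; last exact: H0_coef_eq0.
have ce_eq k : (k < s)%N -> ce w' k = ce w k by move=> ks; rewrite /ce w'w.
rewrite H0_coef_top // /cc w's top_solution_cc // (eq_cauchy_inner ce_eq ce_eq).
rewrite /H0_parameter mulrC divfK ?subrK ?subrr //.
by rewrite !mulf_neq0 // ?pnatr_eq0 // -sqrf_eq0 eps_sqr oner_neq0.
Qed.

End Recursion.

Theorem proposition3p5 (R : realType) (d1 s : nat) (up : bool) (a0 b0 : R[i])
    (hd1 : (2 <= d1)%N) (hs : d1 = (s ^ 2)%N) (ha0 : a0 != 0) (hb0 : b0 != 0) :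
  [/\ s%:R * Qexp s = 2,
      top_resonance s up a0 b0 (iota_at R[i] s s),
      (exists w : coefs R[i], solved_below d1 s up a0 b0 s w)
    & forall w : coefs R[i], solved_below d1 s up a0 b0 s w ->
      [/\ compatible_at d1 s up a0 b0 w s,
          affine_of_dim 1 (step_solution d1 s up a0 b0 w s)
        & exists v : 'cV[R[i]]_4,
          [/\ step_solution d1 s up a0 b0 w s v,
              (exists w' : coefs R[i],
                 extends_at s w v w' /\ solved d1 s up a0 b0 w')
            & forall w' : coefs R[i],
                extends_at s w v w' -> solved d1 s up a0 b0 w' ->
                solves_system d1 (x1_of s up w') (x2_of s w')
                              (u1_of s w') (u2_of s w')
                /\ lies_on_H0 d1 (x1_of s up w') (u1_of s w') (u2_of s w')]]].
Proof.
have s_gt1 : (1 < s)%N by rewrite hs in hd1; nia.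
split.
- by apply: Qexp_top.
- exact: top_resonance_at.
- exact: solved_below_exists.
move=> w w_solved.
have solutionP := top_solutionP s_gt1 hs w_solved.
split.
- by exists (top_solution d1 s up a0 b0 w 0); apply/solutionP; exists 0.
- exact: affine_line (Xmat2_ker_neq0 _ _ _ _) solutionP.
pose v := top_solution d1 s up a0 b0 w (H0_parameter s up w).
have v_step : step_solution d1 s up a0 b0 w s v.
  by apply/solutionP; exists (H0_parameter s up w).
exists v; split=> //; first exact: extends_at_exists.
move=> w' w'_extends w'_solved; split.
  exact: solved_solves_system hs _ w'_solved.
exact: H0_parameter_lies_on_H0 w'_extends w'_solved.
Qed.
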